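(* Let $d\ge 2$ and let $f(z)=z^d+c\in\mathbb{Q}[z]$, and suppose that $c$ is non-zero and is not the reciprocal of an integer. Then $f$ is eventually stable over $\mathbb{Q}$.
   Context: $f^n$ denotes the $n$th iterate of $f$. A polynomial $f\in K[z]$ is eventually stable over a field $K$ if there is an $N\ge 0$ and a fixed $t$, depending only on $f$, such that for all $n>N$, $f^n$ is a product of exactly $t$ irreducible factors in $K[z]$. *)

(* Defs.v *)
From HB Require Import structures.
From mathcomp Require Import all_boot all_order all_algebra.

Set Implicit Arguments.
Unset Strict Implicit.
Unset Printing Implicit Defensive.

Import GRing.Theory.
Local Open Scope ring_scope.

(* Compositional iterate, with f^0 = 'X. *)
Definition poly_iter (K : fieldType) (f : {poly K}) (n : nat) : {poly K} :=
  iter n (fun g => f \Po g) 'X.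

(* Factors are counted with multiplicity.  No separate unit is needed when
   t > 0, since it can be absorbed into one of the factors. *)
Definition product_of_irreducibles (K : fieldType) (p : {poly K}) (t : nat) :
    Prop :=
  exists s : seq {poly K},
    [/\ size s = t, (forall q, q \in s -> irreducible_poly q)
      & p = \prod_(q <- s) q].

Definition eventually_stable (K : fieldType) (f : {poly K}) : Prop :=
  exists N t : nat, forall n : nat, (N < n)%N ->
    product_of_irreducibles (poly_iter f n) t.

(* Main.v *)
Require Import Defs.
From HB Require Import structures.
From mathcomp Require Import all_boot all_order all_algebra.
From Stdlib Require Import Classical.

Set Implicit Arguments.
Unset Strict Implicit.
Unset Printing Implicit Defensive.

Import GRing.Theory.
Local Open Scope ring_scope.

(** Since [c] is neither zero nor the reciprocal of an integer, its numerator is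
    not a unit, so some prime [p] divides it; let [e > 0] be the [p]-adic
    valuation of [c], and write [f = 'X^d + c].  Two facts drive the proof.

    - Modulo [p], the iterate [f^n] is ['X^(d ^ n)], so every factor of positive
      degree reduces to a positive power of ['X] and its constant term is
      divisible by [p].
    - The constant term of [f^n] has valuation exactly [e] for every [n > 0]:
      [f^(n+1)(0) = f^n(0)^d + c], where the first summand has valuation at
      least [d * e > e].

    Hence [f^n] is never a product of more than [e] nonconstant polynomials
    ([prime_power_dvd_coef0], applied to the integral multiples of the iterates
    provided by [integral_multiple_iterate]).  On the other hand, composing the
    factors of [f^n] with [f] turns a factorization of [f^n] into one of
    [f^(n+1)] with as many nonconstant factors.  A factorization that has the
    largest number of factors among all those of all iterates therefore consists
    of irreducible polynomials, and so do all the factorizations of later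
    iterates that come from it ([eventually_stable_of_bound]). *)

Lemma poly_iterSr (K : fieldType) (f : {poly K}) (n : nat) :
  poly_iter f n.+1 = poly_iter f n \Po f.
Proof.
elim: n => [|n IHn]; first by rewrite /poly_iter /= comp_polyXr comp_polyX.
by rewrite -comp_polyA -IHn.
Qed.

Lemma size_comp_gt1 (R : idomainType) (p q : {poly R}) :
  (1 < size p)%N -> (1 < size q)%N -> (1 < size (p \Po q))%N.
Proof.
move=> sp sq.
by have := size_comp_poly p q; case: (size p) sp (size q) sq => [|[|m]] // _
  [|[|k]] // _; case: (size _) => [|[|]].
Qed.

(** Unlike irreducibility, nonconstancy of the factors survives composition with
    another nonconstant polynomial. *)
Definition nonconstant_factorization (K : fieldType) (p : {poly K})
    (s : seq {poly K}) : Prop :=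
  (forall q, q \in s -> (1 < size q)%N) /\ p = \prod_(q <- s) q.

Lemma nonconstant_factorization_iter (K : fieldType) (f : {poly K}) (n m : nat)
    (s : seq {poly K}) :
    (1 < size f)%N -> (n <= m)%N ->
    nonconstant_factorization (poly_iter f n) s ->
  exists2 s', size s' = size s & nonconstant_factorization (poly_iter f m) s'.
Proof.
move=> sf /subnK <-; elim: (m - n)%N => [|k IHk] fs; first by exists s.
have [s' <- [nc' eq']] := IHk fs; exists [seq q \Po f | q <- s'].
  by rewrite size_map.
split=> [_ /mapP[q qs' ->]|]; first exact: size_comp_gt1 (nc' q qs') sf.
by rewrite addSn poly_iterSr eq' rmorph_prod big_map.
Qed.

(** A reducible factor can be split, which lengthens the factorization by one. *)
Lemma refine_or_irreducible (K : fieldType) (p : {poly K})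
    (s : seq {poly K}) :
    nonconstant_factorization p s ->
  (exists2 s', size s' = (size s).+1 & nonconstant_factorization p s') \/
  product_of_irreducibles p (size s).
Proof.
move=> [nc eqp]; have [|no_ref] := classic (exists2 s' : seq {poly K},
  size s' = (size s).+1 & nonconstant_factorization p s'); first by left.
right; exists s; split=> // q qs; split=> [|g sg gq]; first exact: nc.
have q_gt1 := nc q qs; apply/negP => /negP not_assoc; apply: no_ref.
have [h def_q] := dvdpP _ _ gq.
have q0 : q != 0 by rewrite -size_poly_gt0 ltnW.
move: (q0); rewrite def_q mulf_eq0 negb_or => /andP[h0 g0].
exists [:: h, g & rem q s].
  by rewrite /= size_rem // prednK //; case: (s) qs.
split=> [r|].
  rewrite !inE => /or3P[/eqP->|/eqP->|/mem_rem]; last exact: nc.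
    have := size_poly_gt0 h; rewrite h0 leq_eqVlt => /predU1P[/esym sh1|//].
    case/negP: not_assoc; rewrite -dvdp_size_eqp // def_q size_mul //.
    by rewrite sh1 add1n.
  by have := size_poly_gt0 g; rewrite g0 leq_eqVlt eq_sym (negPf sg).
by rewrite !big_cons mulrA -def_q eqp (perm_big _ (perm_to_rem qs)) big_cons.
Qed.

(** Whenever a later iterate has a longer factorization, restart from it; the
    bound allows this only finitely often.  When no later iterate has one, the
    current length is the number of irreducible factors from then on. *)
Lemma eventually_stable_of_bound (K : fieldType) (f : {poly K}) (B : nat) :
    (1 < size f)%N ->
    (forall n s, (0 < n)%N -> nonconstant_factorization (poly_iter f n) s ->
       (size s <= B)%N) ->
  eventually_stable f.
Proof.
move=> sf bnd.
(* [k] bounds the number of times that the factorization can still grow. *)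
suff main k : forall n s, (0 < n)%N ->
    nonconstant_factorization (poly_iter f n) s -> (B < size s + k)%N ->
    eventually_stable f.
  apply: (main B 1%N [:: f]) => //.
  split=> [q|]; first by rewrite inE => /eqP->.
  by rewrite big_seq1 /poly_iter /= comp_polyXr.
elim: k => [|k IHk] n s n_gt0 fs.
  by rewrite addn0 ltnNge (bnd n).
rewrite addnS -addSn => lt_B.
have [[m [s' [le_nm sz_s' fs']]]|maxs] := classic (exists m s',
  [/\ (n <= m)%N, size s' = (size s).+1
    & nonconstant_factorization (poly_iter f m) s']).
  by apply: (IHk m s') => //; rewrite ?sz_s' // (leq_trans n_gt0).
exists n, (size s) => m lt_nm.
have [s1 sz_s1 fs1] := nonconstant_factorization_iter sf (ltnW lt_nm) fs.
have [[s' sz_s' fs']|] := refine_or_irreducible fs1; last by rewrite sz_s1.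
by case: maxs; exists m, s'; rewrite sz_s' sz_s1 ltnW.
Qed.

(** A variant of Eisenstein's criterion: each nonconstant factor of [F]
    contributes a factor [p] to the constant term, because modulo [p] it keeps
    its degree (the leading coefficient does not vanish) and divides a power of
    ['X], hence vanishes at [0].  The scalar [a] absorbs the constants produced
    by Gauss's lemma when the rational factors are replaced by integral ones one
    at a time. *)
Lemma prime_power_dvd_coef0 (p D : nat) (F : {poly int}) (a : rat)
    (s : seq {poly rat}) :
    prime p ->
    (lead_coef F)%:~R != 0 :> 'F_p ->
    map_poly intr F %| ('X^D : {poly 'F_p}) ->
    map_poly intr F = a *: \prod_(q <- s) q ->
    (forall q, q \in s -> (1 < size q)%N) ->
  (p%:Z ^+ size s %| F`_0)%Z.
Proof.
move=> p_pr; elim: s F a => [|q s IHs] F a lcF FD eqF nc.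
  by rewrite expr0 dvd1z.
have ratF_inj := map_inj_poly (@intr_inj rat) (mulr0z 1).
have a0 : a != 0.
  apply: contraNneq lcF => a0; have -> : F = 0.
    by apply: ratF_inj; rewrite eqF a0 scale0r rmorph0.
  by rewrite lead_coef0.
have [] := @dvdpP_rat_int q F.
  by rewrite eqF big_cons dvdpZr // dvdp_mulr.
move=> G [b b0 defq] [H defF].
have sG : (1 < size G)%N.
  have <- := size_map_inj_poly (@intr_inj rat) (mulr0z 1) G.
  by rewrite -(size_scale _ b0) -defq nc ?mem_head.
move: lcF FD; rewrite defF lead_coefM rmorphM rmorphM mulf_eq0 negb_or /=.
case/andP=> lcG lcH GHD; rewrite exprS coef0M dvdz_mul //; last first.
  apply: (IHs H (a * b)) => //; first exact: dvdp_trans (dvdp_mull _ _) GHD.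
    have G0 : map_poly intr G != 0 :> {poly rat}.
      by rewrite -size_poly_gt0 (size_map_inj_poly (@intr_inj rat)) // ltnW.
    apply: (mulfI G0); rewrite -rmorphM -defF [LHS]eqF big_cons defq.
    by rewrite -scalerAl -scalerAr scalerA.
  by move=> r rs; rewrite nc // inE rs orbT.
have GD := dvdp_trans (dvdp_mulr _ (dvdpp _)) GHD.
rewrite (dvdz_pcharf (pchar_Fp p_pr)) -coef_map -horner_coef0.
(* A divisor of ['X^D] is associate to some ['X^k]; the case [k = 0] would make
   [G] constant. *)
move: GD; rewrite -['X]subr0 => /dvdp_exp_XsubCP[[|k] _ Gk].
  by have := eqp_size Gk; rewrite expr0 size_poly1 size_map_poly_id0 // => sG1;
    rewrite sG1 in sG.
by rewrite -/(root _ _) (eqp_root Gk) root_exp_XsubC.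
Qed.

Lemma monic_poly_iter (K : fieldType) (f : {poly K}) (n : nat) :
  (1 < size f)%N -> f \is monic -> poly_iter f n \is monic.
Proof.
move=> sf mf; elim: n => [|n IHn]; first exact: monicX.
by rewrite poly_iterSr monicE lead_coef_comp // (monicP mf) (monicP IHn) expr1n
  mulr1.
Qed.

(** With [c = a / b], clearing denominators in [f^(n+1) = (f^n)^d + c] gives
    [F_(n+1) = b F_n^d + m_n^d a] and [m_(n+1) = b m_n^d], where
    [F_n = m_n f^n].  As [p] divides [a] but not [b], the multiplier [m_n] stays
    prime to [p] and the last summand of [F_(n+1)] disappears modulo [p], while
    at [0] it is the only one of minimal valuation.  The non-divisibility by
    [p ^ e.+1] needs [0 < n], since [F_0] is ['X]. *)
Lemma integral_multiple_iterate (d p e : nat) (a b : int) (n : nat) :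
    (1 < d)%N -> prime p -> (0 < e)%N ->
    ~~ (p %| b)%Z -> (p%:Z ^+ e %| a)%Z -> ~~ (p%:Z ^+ e.+1 %| a)%Z ->
  exists F : {poly int}, exists m : int,
    [/\ ~~ (p %| m)%Z,
        map_poly intr F = m%:~R *: poly_iter ('X^d + (a%:~R / b%:~R)%:P) n
          :> {poly rat},
        map_poly intr F = m%:~R *: 'X^(d ^ n) :> {poly 'F_p},
        (p%:Z ^+ e %| F`_0)%Z
      & (0 < n)%N -> ~~ (p%:Z ^+ e.+1 %| F`_0)%Z].
Proof.
move=> d_gt1 p_pr e_gt0 pb pa pa'; elim: n => [|n [F [m [pm FQ Fp F0 _]]]].
  exists 'X, 1; split; rewrite ?map_polyX ?scale1r ?coefX ?dvdz0 ?expn0 //.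
  by rewrite dvdz1; case: (p) p_pr => [|[]].
have p_dvdM (x y : int) : (p %| x * y)%Z = (p %| x)%Z || (p %| y)%Z.
  by rewrite !dvdzE abszM Euclid_dvdM.
have p_ndvd_md : ~~ (p %| m ^+ d)%Z.
  by rewrite dvdzE abszX Euclid_dvdX // negb_and pm.
have b0 : b != 0 by apply: contraNneq pb => ->; rewrite dvdz0.
(* This is where [1 < d] and [0 < e] enter: [e < e * d]. *)
have pFdvd : (p%:Z ^+ e.+1 %| F`_0 ^+ d)%Z.
  apply: (@dvdz_trans (p%:Z ^+ (e * d))).
    by rewrite dvdz_exp2l // -addn1 (leq_trans _ (leq_mul (leqnn e) d_gt1)) //
      muln2 -addnn leq_add2l.
  by rewrite exprM dvdz_exp2r.
have coef0X (k : nat) : (F ^+ k)`_0 = F`_0 ^+ k.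
  by rewrite -!horner_coef0 horner_exp.
exists (b *: F ^+ d + (m ^+ d * a)%:P), (b * m ^+ d).
have coefE0 : (b *: F ^+ d + (m ^+ d * a)%:P)`_0 = b * F`_0 ^+ d + m ^+ d * a.
  by rewrite coefD coefZ coefC coef0X.
split.
- by rewrite p_dvdM negb_or pb.
- rewrite rmorphD /= map_polyZ map_polyC /= rmorphXn /= FQ exprZn scalerA.
  rewrite comp_polyD comp_Xn_poly comp_polyC -/(poly_iter _ n) scalerDr.
  rewrite !intrM rmorphXn /= -[_ *: _%:P]mul_polyC -polyCM.
  congr (_ + _%:P); rewrite [RHS]mulrA [b%:~R * _]mulrC (mulrAC _ b%:~R).
  by rewrite mulfK // intr_eq0.
- have a0 : a%:~R = 0 :> 'F_p.
    apply/eqP; rewrite -(dvdz_pcharf (pchar_Fp p_pr)).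
    exact: dvdz_trans (dvdz_exp e_gt0 (dvdzz p)) pa.
  rewrite rmorphD /= map_polyZ map_polyC /= rmorphXn /= Fp exprZn scalerA.
  by rewrite -exprM -expnSr !intrM rmorphXn /= a0 mulr0 addr0.
- by rewrite coefE0 rpredD // dvdz_mull // (dvdz_trans _ pFdvd) // dvdz_exp2l.
- move=> _; rewrite coefE0 rpredDl ?(dvdz_mull _ pFdvd) //.
  by rewrite Gauss_dvdzr // coprimezXl // coprimezXr // coprimezE prime_coprime.
Qed.

Theorem corollary6 (d : nat) (c : rat) (hd : (2 <= d)%N) (hc0 : c != 0)
    (hc : ~ (exists2 m : int, m != 0 & c = (m%:~R)^-1)) :
  eventually_stable ('X^d + c%:P : {poly rat}).
Proof.
have numc1 : `|numq c|%N != 1%N.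
  apply/eqP => num1; apply: hc.
  exists (numq c * denq c).
    by rewrite mulf_neq0 ?numq_eq0 ?denq_neq0.
  rewrite -{1}[c]divq_num_den rmorphM invfM; congr (_ * _).
  by case: (numq c) num1 => [[|[]]|[]] //=.
have num0 : (0 < `|numq c|)%N by rewrite absz_gt0 numq_eq0.
set p := pdiv `|numq c|; set e := logn p `|numq c|.
have p_pr : prime p by rewrite pdiv_prime // ltn_neqAle eq_sym numc1.
have e_gt0 : (0 < e)%N by rewrite -pfactor_dvdn // expn1 pdiv_dvd.
have size_f : size ('X^d + c%:P : {poly rat}) = d.+1.
  by rewrite size_polyDl size_polyXn // ltnS
    (leq_trans (size_polyC_leq1 _)) // ltnW.
have sf : (1 < size ('X^d + c%:P)%R)%N by rewrite size_f ltnS ltnW.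
have mf : 'X^d + c%:P \is monic.
  by rewrite monicE lead_coefDl ?lead_coefXn // size_polyXn ltnS
    (leq_trans (size_polyC_leq1 _)) // ltnW.
apply: (@eventually_stable_of_bound _ _ e) => // n s n_gt0 [nc eq_s].
have pb : ~~ (p %| denq c)%Z.
  rewrite dvdzE -prime_coprime // (coprime_dvdl (pdiv_dvd _)) //.
  exact: coprime_num_den.
have [||F [m [pm FQ Fp _ F0]]] :=
  @integral_multiple_iterate d p e (numq c) (denq c) n hd p_pr e_gt0 pb.
- by rewrite dvdzE abszX pfactor_dvdnn.
- by rewrite dvdzE abszX pfactor_dvdn // ltnn.
rewrite divq_num_den in FQ.
have mFp : m%:~R != 0 :> 'F_p by rewrite -(dvdz_pcharf (pchar_Fp p_pr)).
rewrite leqNgt; apply: contra (F0 n_gt0) => lt_es.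
apply: dvdz_trans (dvdz_exp2l _ lt_es) _.
apply: (@prime_power_dvd_coef0 p (d ^ n) F m%:~R) => //.
- suff -> : lead_coef F = m by [].
  apply: (@intr_inj rat).
  rewrite -(lead_coef_map_inj (f := intr)) //; last exact: intr_inj.
  by rewrite FQ lead_coefZ (monicP (monic_poly_iter _ _ _)) // mulr1.
- by rewrite Fp dvdpZl.
- by rewrite FQ -eq_s.
Qed.
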